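(* Let $\beta\in\mathbb{R}$ with $|\beta|<1$ and let $\sigma\in\mathbb{R}$ with $\sigma>e^{2|\beta|-\frac12}$. For $H\in(0,1)$ let $(X_t^H)_{t\in[0,1]}$ be the real-valued stochastic process defined by $$dX_t^H=-\beta X_t^H\,dt+\sigma\,dB_t^H,\qquad X_0^H=0,$$ where $B^H$ is a one-dimensional fractional Brownian motion with Hurst parameter $H$. Then there exists a constant $c>0$, independent of $H$, such that for every $H\in(0,1)$ $$\mathbb{E}\Big[\sup_{t\in[0,1]}X_t^H\Big]\ge c\left\{e^{-\frac12}\sqrt{\frac1H\log\left(\frac{\sigma C_\beta}{e^{-\frac12}}\right)}\right\},\qquad\text{where } C_\beta=e^{-2|\beta|}.$$
   Context: A (one-dimensional) fractional Brownian motion on $[0,1]$ with Hurst parameter $H\in(0,1)$ is a centered Gaussian process $(B^H_t)_{t\in[0,1]}$ with continuous paths and covariance $\mathbb{E}[B^H_tB^H_s]=\tfrac12\left(|t|^{2H}+|s|^{2H}-|t-s|^{2H}\right)$. The linear stochastic differential equation is understood pathwise in integral form: $X^H_t=X^H_0-\beta\int_0^tX^H_s\,ds+\sigma B^H_t$ for all $t\in[0,1]$ (its unique continuous solution is a fractional Ornstein-Uhlenbeck process). *)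

(* Defs.v *)
From HB Require Import structures.
From mathcomp Require Import all_boot all_order all_algebra.
From mathcomp Require Import all_classical all_reals all_analysis.
Set Implicit Arguments.
Unset Strict Implicit.
Unset Printing Implicit Defensive.
Import Order.TTheory GRing.Theory Num.Theory.
Import numFieldNormedType.Exports.
Local Open Scope classical_set_scope.
Local Open Scope ring_scope.

(* The point mass is the normal law of standard deviation 0; it is a separate
   case because [normal_prob m 0] is, by library convention, the uniform law
   on [0, 1]. *)
Definition gaussian_rv (R : realType) (d : measure_display)
    (T : measurableType d) (P : probability T R) (Y : T -> R) : Prop :=
  measurable_fun [set: T] Y /\
  exists m s : R, 0 <= s /\
    forall A : set R, measurable A ->
      pushforward P Y A = if s == 0 then \d_m A else normal_prob m s A.

(* A process with index set I is a function R -> T -> R of which only the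
   values at times in I matter. *)
Definition gaussian_process (R : realType) (d : measure_display)
    (T : measurableType d) (P : probability T R)
    (I : set R) (Y : R -> T -> R) : Prop :=
  forall (n : nat) (t a : 'I_n -> R), (forall i, I (t i)) ->
    gaussian_rv P (fun w => \sum_(i < n) a i * Y (t i) w).

Definition continuous_paths (R : realType) (T : Type)
    (I : set R) (Y : R -> T -> R) : Prop :=
  forall w : T, {within I, continuous (fun t => Y t w)}.

Record fractional_brownian_motion (R : realType) (d : measure_display)
    (T : measurableType d) (P : probability T R)
    (H : R) (B : R -> T -> R) : Prop := FractionalBrownianMotion {
  fbm_gaussian : gaussian_process P `[0, 1]%classic B ;
  fbm_centered : forall t : R, t \in `[0, 1] -> ('E_P[B t] = 0)%E ;
  fbm_continuous : continuous_paths `[0, 1]%classic B ;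
  fbm_covariance : forall t s : R, t \in `[0, 1] -> s \in `[0, 1] ->
    ('E_P[fun w => (B t w * B s w)%R] =
     (2^-1 * (`|t| `^ (2 * H) + `|s| `^ (2 * H)
              - `|t - s| `^ (2 * H)))%:E)%E
}.

(* dX = - beta X dt + sigma dB on [0, 1], pathwise and in integral form. *)
Record linear_sde_solution (R : realType) (T : Type)
    (beta sigma : R) (B X : R -> T -> R) : Prop := LinearSdeSolution {
  sde_continuous : continuous_paths `[0, 1]%classic X ;
  sde_equation : forall (w : T) (t : R), t \in `[0, 1] ->
    X t w = X 0 w - beta * (\int[lebesgue_measure]_(s in `[0, t]) X s w)
            + sigma * B t w
}.

(* Main.v *)
Require Import Defs.
From HB Require Import structures.
From mathcomp Require Import all_boot all_order all_algebra.
From mathcomp Require Import all_classical all_reals all_analysis.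
From mathcomp Require Import measurable_realfun zify ring lra.
Set Implicit Arguments.
Unset Strict Implicit.
Unset Printing Implicit Defensive.
Import Order.TTheory GRing.Theory Num.Theory.
Import numFieldNormedType.Exports.
Local Open Scope classical_set_scope.
Local Open Scope ring_scope.

(** Since $\beta$ and $\sigma$ are fixed before the constant, the logarithm
    only contributes a constant factor, and the claim is
    $E[\sup X] \ge c\,H^{-1/2}$ uniformly in $H \in (0,1)$.

    From $X$ to $B$.  Integrating $|X_t| \le |\beta|\int_0^t|X| +
    \sigma|B_t|$ over $[0,\varepsilon]$ and using $|\beta| < 1$ bounds
    $\int_0^\varepsilon|X|$ by $\sigma W/(1-|\beta|)$, where
    $W = \int_0^\varepsilon|B|$.  Hence
    $X_t \ge \sigma(B_t - \kappa W)$ on $[0,\varepsilon]$ with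
    $\kappa = |\beta|/(1-|\beta|)$ (sde_path_lower_bound), and
    $E[W] \le \varepsilon\,\varepsilon^H$ by Tonelli
    (fbm_Rexp_path_integral).  Because $X_0 = 0$, the supremum of $X$ is
    nonnegative, so it suffices to find one large value of $B$ with a
    probability bounded below.

    Large values of $B$.  For a centered Gaussian family $Y_k$ with
    covariance $c_{kl}$, the normalized partition function
    $z = \mathrm{avg}_k \exp(bY_k - b^2c_{kk}/2)$ has mean 1 and second
    moment $\mathrm{avg}_{kl} \exp(b^2c_{kl})$.  When the latter is at most
    $C$, $z \ge 1/2$ has probability at least $1/(4C)$, and on that event
    some $Y_k$ exceeds $bc_{kk}/2 - 1/b$ (gaussian_max_second_moment).  Both
    moments are exponential moments of the variables $Y_k$ and $Y_k + Y_l$,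
    so the Gaussian laws of finite linear combinations determine them
    (gaussian_rv_expR).

    The order $H^{-1/2}$.  Take $N \ge e^{1/(4H)}$ grid points $t_k = k/N$
    and $Y_k = B_{t_k} - A$, with $A$ the average of $B$ over the grid.
    Recentering removes the part of the covariance common to all points: what
    remains is at most
    $\frac12(1-|t_k-t_l|^{2H})$ up to an error of order $H$, and
    $1 - x^{2H} \le 2H\log(1/x)$.  For $b^2 = 1/(2H)$ the second moment is
    therefore dominated by the average of $|t_k-t_l|^{-1/2}$, which is
    bounded, while $c_{kk} \ge 1/4$.  So some $B_{t_k} - A$ is at least of
    order $b \sim H^{-1/2}$ with a probability that does not depend on $H$,
    whereas $E|A| \le 1$ and $\kappa E[W]\le\kappa$
    (expected_sup_ge_sqrt).  This gives
    $E[\sup X] \ge \sigma(c_2H^{-1/2} - c_3)$.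

    When $H$ is not small the subtracted constant may win.  The same second
    moment argument for the single point $t = \varepsilon$, with
    $\varepsilon$ small enough for $\kappa E[W]$ to be negligible against
    $\varepsilon^H$, gives $E[\sup X] \ge \sigma c_1$ for every $H$
    (expected_sup_ge_cst), and the two bounds combine linearly. *)

(** * Exponential moments of a normal law *)

(** The density of the normal law is its Radon-Nikodym derivative with respect
    to the Lebesgue measure, almost everywhere; integrals against the law then
    follow from the change of variables for the abstract derivative. *)
Lemma integral_normal_prob (R : realType) (m s : R) (f : R -> \bar R) :
  measurable_fun setT f -> (forall x, 0 <= f x)%E ->
  (\int[normal_prob m s]_x f x =
   \int[lebesgue_measure]_x (f x * (normal_pdf m s x)%:E))%E.
Proof.
move=> mf f0.
have dom := @normal_prob_dominates R m s.
have mp : measurable_fun [set: R] (EFin \o normal_pdf m s).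
  by apply/measurable_EFinP; exact: measurable_normal_pdf.
have gi := Radon_Nikodym_SigmaFinite.f_integrable dom.
rewrite -(Radon_Nikodym_SigmaFinite.change_of_variables dom f0 measurableT mf).
apply: ae_eq_integral => //.
- by apply: emeasurable_funM => //; exact: measurable_int gi.
- exact: emeasurable_funM.
- apply: (@filterS _ _ _ _ _ _ (integral_ae_eq measurableT gi mp _)).
    by move=> x eqx _ /=; rewrite eqx.
  move=> E _ mE.
  by rewrite -(Radon_Nikodym_SigmaFinite.f_integral dom mE).
Qed.

(** Completing the square: multiplying a normal density by $e^{bx}$ shifts its
    mean by $bs^2$, and a density has total mass 1. *)
Lemma integral_expR_normal_pdf (R : realType) (m s b : R) : s != 0 ->
  (\int[lebesgue_measure]_x ((expR (b * x))%:E * (normal_pdf m s x)%:E) =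
   (expR (b * m + b ^+ 2 * s ^+ 2 / 2))%:E)%E.
Proof.
move=> s0.
have shift x : expR (b * x) * normal_pdf m s x =
    expR (b * m + b ^+ 2 * s ^+ 2 / 2) * normal_pdf (m + b * s ^+ 2) s x.
  rewrite !normal_pdfE//= /normal_fun mulrCA [RHS]mulrCA; congr (_ * _).
  by rewrite -!expRD; congr expR; field.
under eq_integral do rewrite -EFinM shift EFinM.
rewrite integralZl//; last exact: integrable_normal_pdf.
by rewrite integral_normal_pdf mule1.
Qed.

Lemma gaussian_rv_mgf (R : realType) (d : measure_display)
    (T : measurableType d) (P : probability T R) (Y : T -> R) :
  gaussian_rv P Y -> exists m s : R, forall b,
  (\int[P]_w (expR (b * Y w))%:E = (expR (b * m + b ^+ 2 * s ^+ 2 / 2))%:E)%E.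
Proof.
move=> [mY [m [s [s0 YE]]]]; exists m, s => b.
have mY' : measurable_fun setT (Y : T -> measurableTypeR R) := mY.
have mexp : measurable_fun setT (fun x : measurableTypeR R => (expR (b * x))%:E).
  by apply/measurable_EFinP; exact: measurableT_comp.
have := @ge0_integral_pushforward _ _ _ _ R _ mY' P setT
  (fun x => (expR (b * x))%:E) measurableT mexp
  (fun y _ => expR_ge0 _).
rewrite preimage_setT => <-.
have [s00|sN0] := eqVneq s 0.
  transitivity (\int[@dirac _ (measurableTypeR R) m R]_x (expR (b * x))%:E)%E.
    apply: eq_measure_integral => A mA _.
    by have := YE A mA; rewrite s00 eqxx.
  by rewrite integral_dirac// diracT mul1e s00 expr0n/= mulr0 mul0r addr0.
transitivity (\int[normal_prob m s]_x (expR (b * x))%:E)%E.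
  apply: eq_measure_integral => A mA _.
  by have := YE A mA; rewrite (negbTE sN0).
rewrite (integral_normal_prob _ _ mexp (fun=> expR_ge0 _)).
exact: integral_expR_normal_pdf.
Qed.

Lemma expR_sub1_ge (R : realType) (x : R) : x <= expR x - 1.
Proof. by have := expR_ge1Dx x; lra. Qed.

Lemma expR_sub1_le (R : realType) (x : R) : expR x - 1 <= x * expR x.
Proof.
have := expR_ge1Dx (- x); rewrite expRN => h.
have e0 := expR_gt0 x.
have : (1 - x) * expR x <= (expR x)^-1 * expR x by rewrite ler_pM2r.
by rewrite mulVf ?gt_eqF//; lra.
Qed.

(** Second moments will be read off exponential moments through
    $y^2 = \lim_{b\to0}(e^{by}+e^{-by}-2)/b^2$; the error is written with
    exponentials so that its expectation is finite for a Gaussian $y$. *)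
Lemma cosh_taylor2 (R : realType) (b y : R) : 0 < b -> b <= 1 ->
  `|expR (b * y) + expR (- (b * y)) - 2 - (b * y) ^+ 2|
    <= b ^+ 3 * (expR (4 * y) + expR (- (4 * y))).
Proof.
move=> b0 b1.
(* both sides are even in y *)
wlog y0 : y / 0 <= y.
  move=> th; have [/th//|y0] := leP 0 y.
  have := th (- y); rewrite !mulrN !opprK sqrrN oppr_ge0 => /(_ (ltW y0)).
  by rewrite [expR (- _) + _ in X in X -> _]addrC [X in _ <= _ * X]addrC.
set h := b * y.
have h0 : 0 <= h by rewrite mulr_ge0// ltW.
have hy : h <= y by rewrite ler_piMl.
have e0 := expR_gt0 h.
have E : expR h + expR (- h) - 2 = expR (- h) * (expR h - 1) ^+ 2.
  rewrite expRN; field; exact: lt0r_neq0.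
have lo : h ^+ 2 - h ^+ 3 <= expR h + expR (- h) - 2.
  rewrite E; apply: (@le_trans _ _ (expR (- h) * h ^+ 2)).
    have := expR_ge1Dx (- h); have : 0 <= h ^+ 2 by exact: sqr_ge0.
    move=> a c; have : (1 - h) * h ^+ 2 <= expR (- h) * h ^+ 2 by rewrite ler_wpM2r.
    by rewrite mulrBl mul1r -exprS.
  rewrite ler_wpM2l ?expR_ge0// lerXn2r ?nnegrE ?expR_sub1_ge//.
  by rewrite (le_trans h0)// expR_sub1_ge.
have hi : expR h + expR (- h) - 2 <= h ^+ 2 + h ^+ 3 * expR h.
  rewrite E; apply: (@le_trans _ _ (expR (- h) * (h * expR h) ^+ 2)).
    rewrite ler_wpM2l ?expR_ge0// lerXn2r ?nnegrE ?expR_sub1_le//.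
      by rewrite (le_trans h0)// expR_sub1_ge.
    by rewrite mulr_ge0// expR_ge0.
  have -> : expR (- h) * (h * expR h) ^+ 2 = h ^+ 2 * expR h.
    by rewrite expRN; field; exact: lt0r_neq0.
  have := expR_sub1_le h => k.
  have : h ^+ 2 * expR h <= h ^+ 2 * (1 + h * expR h).
    by rewrite ler_wpM2l ?sqr_ge0//; lra.
  by rewrite mulrDr mulr1 mulrA -exprSr.
have eh1 : 1 <= expR h by rewrite -expR0 ler_expR.
have h3 : h ^+ 3 * expR h <= b ^+ 3 * expR (4 * y).
  rewrite /h exprMn -mulrA ler_wpM2l ?exprn_ge0 ?(ltW b0)//.
  rewrite (_ : 4 * y = 3%:R * y + y); last by rewrite -[4]/(3 + 1)%:R natrD; ring.
  rewrite expRD expRM_natl ler_pM ?exprn_ge0 ?expR_ge0//; last by rewrite ler_expR.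
  rewrite lerXn2r ?nnegrE ?expR_ge0//.
  by have := expR_ge1Dx y; lra.
have h3' : h ^+ 3 <= h ^+ 3 * expR h by rewrite ler_peMr// exprn_ge0.
have : 0 <= b ^+ 3 * expR (- (4 * y)).
  by rewrite mulr_ge0 ?expR_ge0// exprn_ge0// ltW.
by rewrite ler_norml mulrDr; lra.
Qed.

Lemma eq_of_le_linear (R : realType) (x y K : R) :
  (forall b, 0 < b -> b <= 1 -> `|x - y| <= b * K) -> x = y.
Proof.
move=> xyK; apply/eqP; rewrite -subr_eq0 -normr_eq0; apply/negP => /negP n0.
set D := `|x - y| in xyK n0 *.
have D0 : 0 < D by rewrite lt_def n0 normr_ge0.
have K0 : 0 <= K by have := xyK 1 ltr01 (lexx _); rewrite mul1r; lra.
have S0 : 0 < D + K + 1 by lra.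
have q0 : 0 < D / (D + K + 1) by rewrite divr_gt0.
have q1 : D / (D + K + 1) <= 1 by rewrite ler_pdivrMr// mul1r; lra.
have := xyK _ q0 q1; rewrite mulrAC ler_pdivlMr//.
by nra.
Qed.

(** * Real-valued expectations and centered Gaussian variables *)

Section real_expectation.
Context (d : measure_display) (T : measurableType d) (R : realType).
Variable P : probability T R.
Implicit Types f g : T -> R.
Local Notation L1 f := (P.-integrable [set: T] (EFin \o f)).

Lemma L1_cst (c : R) : L1 (fun=> c).
Proof. exact: finite_measure_integrable_cst. Qed.

Lemma L1D f g : L1 f -> L1 g -> L1 (fun w => f w + g w).
Proof. by move=> If Ig; have := integrableD measurableT If Ig. Qed.

Lemma L1Z c f : L1 f -> L1 (fun w => c * f w).
Proof. by move=> If; have := integrableZl measurableT c If. Qed.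

Lemma L1_sum n (F : 'I_n -> T -> R) : (forall i, L1 (F i)) ->
  L1 (fun w => \sum_(i < n) F i w).
Proof.
move=> IF.
rewrite (_ : _ \o _ = fun w => (\sum_(i < n) (F i w)%:E)%E); last first.
  by apply/funext => w /=; rewrite sumEFin.
apply: (@integrable_sum _ _ _ P setT measurableT _ _ _
  (fun i w => (F i w)%:E)) => i _; exact: IF.
Qed.

Lemma L1_dom f g : measurable_fun setT f -> L1 g ->
  (forall w, `|f w| <= g w) -> L1 f.
Proof.
move=> mf Ig fg; apply: (le_integrable measurableT _ _ Ig).
  exact/measurable_EFinP.
by move=> w _; rewrite /= lee_fin; exact: le_trans (fg w) (ler_norm _).
Qed.

Lemma L1_measurable f : L1 f -> measurable_fun setT f.
Proof. by move/(measurable_int P)/measurable_EFinP. Qed.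

Lemma Rexp_cst (c : R) : \int[P]_w c = c.
Proof.
rewrite (Rintegral_cst P measurableT).
rewrite [fine _](_ : _ = 1) ?mulr1//.
have h := probability_setT P.
exact: (congr1 (@fine R) h).
Qed.

Lemma Rexp_sum n (F : 'I_n -> T -> R) : (forall i, L1 (F i)) ->
  \int[P]_w (\sum_(i < n) F i w) = \sum_(i < n) \int[P]_w F i w.
Proof.
elim: n F => [|n IH] F IF.
  rewrite big_ord0 -[RHS]Rexp_cst; apply: eq_Rintegral => w _.
  by rewrite big_ord0.
rewrite big_ord_recr/= -IH// -RintegralD//; last exact: L1_sum.
by apply: eq_Rintegral => w _; rewrite big_ord_recr.
Qed.

Lemma L1M_of_L2 f g : measurable_fun setT f -> measurable_fun setT g ->
  L1 (fun w => f w ^+ 2) -> L1 (fun w => g w ^+ 2) -> L1 (fun w => f w * g w).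
Proof.
move=> mf mg If Ig; apply: (L1_dom _ (L1D If Ig)); first exact: measurable_funM.
move=> w; rewrite ler_norml; apply/andP; split; nra.
Qed.

Lemma L1_of_L2 f : measurable_fun setT f -> L1 (fun w => f w ^+ 2) -> L1 f.
Proof.
move=> mf If; apply: (L1_dom _ (L1D (L1_cst 1) If)) => // w.
by rewrite ler_norml; apply/andP; split; nra.
Qed.

Lemma ge0_integral_EFinP f c : measurable_fun setT f -> (forall w, 0 <= f w) ->
  (\int[P]_w (f w)%:E = c%:E)%E -> L1 f /\ \int[P]_w f w = c.
Proof.
move=> mf f0 fc; split; last by rewrite /Rintegral fc.
apply/integrableP; split; first exact/measurable_EFinP.
under eq_integral do rewrite /= ger0_norm//.
by rewrite fc ltry.
Qed.

(** The parameters of the law are not given, only the first two moments.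
    The exponential moments $e^{bm+b^2s^2/2}$ identify them: $e^{bY} \ge 1+bY$
    forces $bm + b^2s^2/2 \ge 0$ for all $b$, hence $m = 0$, and
    the expansion of cosh at $b \to 0$ forces $s^2 = v$. *)
Lemma gaussian_rv_expR (Y : T -> R) (v : R) :
  gaussian_rv P Y -> L1 (fun w => Y w ^+ 2) -> \int[P]_w Y w = 0 ->
  \int[P]_w Y w ^+ 2 = v ->
  forall b, L1 (fun w => expR (b * Y w)) /\
    \int[P]_w expR (b * Y w) = expR (b ^+ 2 * v / 2).
Proof.
move=> gY IY2 EY EY2.
have mY : measurable_fun setT Y by case: gY.
have IY : L1 Y by exact: L1_of_L2.
have [m [s mgf]] := gaussian_rv_mgf gY.
have {mgf} mgf b : L1 (fun w => expR (b * Y w)) /\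
    \int[P]_w expR (b * Y w) = expR (b * m + b ^+ 2 * s ^+ 2 / 2).
  apply: ge0_integral_EFinP; last exact: mgf.
    by apply: measurableT_comp => //; exact: measurable_funM.
  by move=> w; exact: expR_ge0.
have m0 : m = 0.
  have ge0 b : 0 <= b * m + b ^+ 2 * s ^+ 2 / 2.
    have [Ib Eb] := mgf b.
    rewrite -ler_expR expR0 -Eb.
    have E1 : \int[P]_w (1 + b * Y w) = 1.
      by rewrite RintegralD//; [rewrite Rexp_cst RintegralZl// EY mulr0 addr0
        | exact: L1_cst | exact: L1Z].
    rewrite -[leLHS]E1; apply: le_Rintegral => //.
      by apply: L1D; [exact: L1_cst | exact: L1Z].
    by move=> w _; exact: expR_ge1Dx.
  apply/eqP; rewrite -sqrf_eq0; apply/eqP.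
  set t := 1 + s ^+ 2.
  have t0 : 0 < t by rewrite /t; have := sqr_ge0 s; lra.
  (* close to the minimizer of the quadratic in b, and defined even if s = 0 *)
  have := ge0 (- m / t).
  have -> : - m / t * m + (- m / t) ^+ 2 * s ^+ 2 / 2 =
      - m ^+ 2 / (2 * t ^+ 2) * (2 * t - s ^+ 2).
    by field; exact: lt0r_neq0.
  rewrite pmulr_lge0; last by rewrite /t; have := sqr_ge0 s; lra.
  rewrite pmulr_lge0; last by rewrite invr_gt0 mulr_gt0// exprn_gt0.
  by have := sqr_ge0 m; lra.
have sv : s ^+ 2 = v.
  pose K := \int[P]_w (expR (4 * Y w) + expR (- (4 * Y w))).
  pose x := s ^+ 2 / 2.
  apply: (@eq_of_le_linear _ _ _ (K + 2 * x ^+ 2 * expR x)) => b b0 b1.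
  have [[Ip Ep] [Im Em]] := (mgf b, mgf (- b)).
  have [[I4 _] [I4m _]] := (mgf 4, mgf (- 4)).
  have EN c : (fun w => expR (- (c * Y w))) = (fun w => expR (- c * Y w)).
    by apply/funext => w; rewrite mulNr.
  have IK : L1 (fun w => expR (4 * Y w) + expR (- (4 * Y w))).
    by apply: L1D => //; rewrite EN.
  have {}Ep : \int[P]_w expR (b * Y w) = expR (b ^+ 2 * x).
    by rewrite Ep m0 /x; congr expR; field.
  have {}Em : \int[P]_w expR (- b * Y w) = expR (b ^+ 2 * x).
    by rewrite Em m0 /x; congr expR; field.
  pose f w := expR (b * Y w) + expR (- (b * Y w)) - 2 - (b * Y w) ^+ 2.
  have fE : f = fun w => (expR (b * Y w) + expR (- b * Y w))
      + (- 2 + (- b ^+ 2) * Y w ^+ 2).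
    by apply/funext => w; rewrite /f mulNr; ring.
  have I2 : L1 (fun w => - 2 + (- b ^+ 2) * Y w ^+ 2).
    by apply: L1D; [exact: L1_cst | exact: L1Z].
  have If : L1 f by rewrite fE; apply: L1D => //; exact: L1D.
  have Ef : \int[P]_w f w = 2 * (expR (b ^+ 2 * x) - 1) - b ^+ 2 * v.
    rewrite fE RintegralD//; last exact: L1D.
    rewrite RintegralD// Ep Em RintegralD//; [|exact: L1_cst|exact: L1Z].
    rewrite Rexp_cst RintegralZl// EY2; ring.
  have : `|\int[P]_w f w| <= b ^+ 3 * K.
    apply: le_trans (le_normr_Rintegral measurableT If) _.
    rewrite /K -RintegralZl//; apply: le_Rintegral => //.
    - by have := integrable_norm If.
    - exact: L1Z.
    - by move=> w _; exact: cosh_taylor2.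
  rewrite Ef; set y := b ^+ 2 * x.
  have x0 : 0 <= x by rewrite /x divr_ge0// sqr_ge0.
  have y0 : 0 <= y by rewrite /y mulr_ge0// sqr_ge0.
  have b21 : b ^+ 2 <= 1 by rewrite exprn_ile1// ltW.
  have yx : y <= x by rewrite /y ler_piMl.
  have yy : y * (expR y - 1) <= b ^+ 3 * (x ^+ 2 * expR x).
    apply: (@le_trans _ _ (y * (y * expR y))).
      by rewrite ler_wpM2l// expR_sub1_le.
    apply: (@le_trans _ _ (y ^+ 2 * expR x)).
      by rewrite mulrA -expr2 ler_wpM2l ?sqr_ge0// ler_expR.
    rewrite mulrA ler_wpM2r ?expR_ge0// /y exprMn ler_wpM2r ?sqr_ge0//.
    by rewrite -exprM ler_wiXn2l// ltW.
  have := expR_sub1_le y; have := expR_sub1_ge y.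
  have sx : b ^+ 2 * s ^+ 2 = 2 * y by rewrite /y /x; field.
  move=> h1 h2 h3.
  rewrite -(@ler_pM2l _ (b ^+ 2)) ?exprn_gt0// -[X in X * `|_|]ger0_norm ?sqr_ge0//.
  rewrite -normrM mulrBr sx (_ : b ^+ 2 * (b * _) =
    b ^+ 3 * (K + 2 * x ^+ 2 * expR x)); last by ring.
  move: h3; rewrite !ler_norml; lra.
move=> b; have [Ib ->] := mgf b; split => //.
by rewrite m0 sv mulr0 add0r.
Qed.

End real_expectation.

(** * The second moment method for the maximum of a Gaussian family *)

Section second_moment.
Context (d : measure_display) (T : measurableType d) (R : realType).
Variable P : probability T R.
Local Notation L1 f := (P.-integrable [set: T] (EFin \o f)).

(** Paley-Zygmund inequality for the normalized partition function $z$ of the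
    family.  Instead of an event, the conclusion gives a random variable below
    its indicator: $\zeta = (z - \frac12 - z^2/(4C))/C$ is at most 1
    everywhere, nonpositive where $z < 1/2$, and its expectation only involves
    the first two moments of $z$. *)
Lemma gaussian_max_second_moment (n : nat) (Y : 'I_n.+1 -> T -> R)
    (b C u : R) :
  let c k l := \int[P]_w (Y k w * Y l w) in
  (forall k, gaussian_rv P (Y k)) ->
  (forall k l, gaussian_rv P (fun w => Y k w + Y l w)) ->
  (forall k, L1 (fun w => Y k w ^+ 2)) ->
  (forall k, \int[P]_w Y k w = 0) ->
  0 < b -> 0 < C ->
  \sum_(k < n.+1) \sum_(l < n.+1) expR (b ^+ 2 * c k l) <= n.+1%:R ^+ 2 * C ->
  (forall k, u <= b * c k k / 2 - b^-1) ->
  exists zeta : T -> R, [/\ L1 zeta, (4 * C)^-1 <= \int[P]_w zeta w &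
    forall w, zeta w <= 0 \/ (zeta w <= 1 /\ exists k, u <= Y k w)].
Proof.
move=> c gY gYY IY2 EY b0 C0 hC hu.
have mY k : measurable_fun setT (Y k) by case: (gY k).
have IY k : L1 (Y k) by exact: L1_of_L2.
have IYY k l : L1 (fun w => Y k w * Y l w) by exact: L1M_of_L2.
have mgf1 k : L1 (fun w => expR (b * Y k w)) /\
    \int[P]_w expR (b * Y k w) = expR (b ^+ 2 * c k k / 2).
  by apply: gaussian_rv_expR => //; apply: eq_Rintegral => w _; rewrite expr2.
have mgf2 k l : L1 (fun w => expR (b * (Y k w + Y l w))) /\
    \int[P]_w expR (b * (Y k w + Y l w)) =
      expR (b ^+ 2 * (c k k + 2 * c k l + c l l) / 2).
  have sqE : (fun w => (Y k w + Y l w) ^+ 2) =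
      fun w => (Y k w * Y k w + 2 * (Y k w * Y l w)) + Y l w * Y l w.
    by apply/funext => w; ring.
  have I1 : L1 (fun w => Y k w * Y k w + 2 * (Y k w * Y l w)).
    by apply: L1D => //; exact: L1Z.
  apply: gaussian_rv_expR => //.
  - by rewrite sqE; apply: L1D.
  - by rewrite RintegralD// !EY addr0.
  - by rewrite sqE !RintegralD ?RintegralZl//; exact: L1Z.
pose N : R := n.+1%:R.
have N0 : 0 < N by rewrite ltr0n.
pose a k := expR (- (b ^+ 2 * c k k / 2)).
pose z w := N^-1 * \sum_k (a k * expR (b * Y k w)).
have Iz : L1 z.
  by apply: L1Z; apply: L1_sum => k; apply: L1Z; exact: (mgf1 k).1.
have Ez : \int[P]_w z w = 1.
  rewrite RintegralZl//; last first.
    by apply: L1_sum => k; apply: L1Z; exact: (mgf1 k).1.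
  rewrite Rexp_sum; last by move=> k; apply: L1Z; exact: (mgf1 k).1.
  rewrite (eq_bigr (fun=> 1)); last first.
    move=> k _; rewrite RintegralZl//; last exact: (mgf1 k).1.
    by rewrite (mgf1 k).2 /a -expRD addNr expR0.
  by rewrite sumr_const card_ord mulVf// gt_eqF.
have z2E : (fun w => z w ^+ 2) = fun w => (N ^+ 2)^-1 *
    \sum_k \sum_l (a k * a l) * expR (b * (Y k w + Y l w)).
  apply/funext => w; rewrite /z exprMn exprVn; congr (_ * _).
  rewrite expr2 mulr_suml; apply: eq_bigr => k _.
  rewrite mulr_sumr; apply: eq_bigr => l _.
  by rewrite mulrDr expRD; ring.
have Ikl k l : L1 (fun w => (a k * a l) * expR (b * (Y k w + Y l w))).
  by apply: L1Z; exact: (mgf2 k l).1.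
have Iz2 : L1 (fun w => z w ^+ 2).
  by rewrite z2E; apply: L1Z; do 2 apply: L1_sum => ?.
have Ez2 : \int[P]_w z w ^+ 2 <= C.
  rewrite z2E RintegralZl//; last by do 2 apply: L1_sum => ?.
  rewrite Rexp_sum; last by move=> k; apply: L1_sum.
  rewrite mulrC ler_pdivrMr ?exprn_gt0// [leRHS]mulrC.
  apply: le_trans hC; apply: ler_sum => k _.
  rewrite Rexp_sum//; apply: ler_sum => l _.
  rewrite RintegralZl//; last exact: (mgf2 k l).1.
  rewrite (mgf2 k l).2 /a -!expRD ler_expR; lra.
exists (fun w => C^-1 * (z w + (- 2^-1 + - (4 * C)^-1 * z w ^+ 2))).
have I1 : L1 (fun w => - 2^-1 + - (4 * C)^-1 * z w ^+ 2).
  by apply: L1D; [exact: L1_cst | exact: L1Z].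
split.
- by apply: L1Z; exact: L1D.
- rewrite RintegralZl//; last exact: L1D.
  rewrite RintegralD// Ez RintegralD//; [|exact: L1_cst|exact: L1Z].
  rewrite Rexp_cst RintegralZl//.
  rewrite invfM mulrC ler_pM2l ?invr_gt0//.
  have : (4 * C)^-1 * (\int[P]_w z w ^+ 2) <= (4 * C)^-1 * C.
    by rewrite ler_pM2l// invr_gt0 mulr_gt0.
  rewrite (_ : (4 * C)^-1 * C = 4^-1); last by field; exact: lt0r_neq0.
  lra.
move=> w.
have z2 : 0 <= (4 * C)^-1 * z w ^+ 2.
  by rewrite mulr_ge0 ?sqr_ge0// invr_ge0 mulr_ge0// ltW.
have [zlt|zge] := ltP (z w) (2^-1).
  by left; rewrite pmulr_rle0 ?invr_gt0//; lra.
right; split.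
  rewrite mulrC ler_pdivrMr// mul1r.
  have : 0 <= (4 * C)^-1 * (z w - 2 * C) ^+ 2.
    by rewrite mulr_ge0 ?sqr_ge0// invr_ge0 mulr_ge0// ltW.
  rewrite (_ : _ * (_ - _) ^+ 2 = (4 * C)^-1 * z w ^+ 2 - z w + C); last first.
    by field; exact: lt0r_neq0.
  lra.
(* an average at least 1/2 has a term at least 1/2 *)
have [k hk] : exists k, 2^-1 <= a k * expR (b * Y k w).
  apply/existsP; apply: contraT; rewrite negb_exists => /forallP hlt.
  suff : z w < 2^-1 by rewrite ltNge zge.
  rewrite /z mulrC ltr_pdivrMr//.
  have -> : 2^-1 * N = \sum_(k < n.+1) 2^-1 by rewrite sumr_const card_ord mulr_natr.
  apply: ltr_sum => [|k _]; last by rewrite ltNge hlt.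
  by apply/hasP; exists ord0; rewrite ?mem_index_enum.
exists k; apply: le_trans (hu k) _.
(* log 2 is replaced by 1 in the threshold *)
have h2 : 2^-1 >= expR (- 1) :> R.
  rewrite expRN lef_pV2 ?posrE ?expR_gt0//.
  by have := expR_ge1Dx (1 : R); lra.
have := le_trans h2 hk; rewrite /a -expRD ler_expR => h.
rewrite -(@ler_pM2l _ b)// mulrBr mulfV ?gt_eqF//.
by lra.
Qed.

End second_moment.

(** * Fractional Brownian motion: covariances, absolute moments, joint measurability *)

Section fbm.
Context (d : measure_display) (T : measurableType d) (R : realType).
Variables (P : probability T R) (H : R) (B : R -> T -> R).
Hypothesis fbm : fractional_brownian_motion P H B.
Hypothesis H0 : 0 < H.
Local Notation L1 f := (P.-integrable [set: T] (EFin \o f)).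

Lemma fbm_measurable t : 0 <= t <= 1 -> measurable_fun setT (B t).
Proof.
move=> t01.
have := @fbm_gaussian _ _ _ _ _ _ fbm 1 (fun=> t) (fun=> 1) (fun=> t01).
move=> [+ _]; congr measurable_fun; apply/funext => w.
by rewrite big_ord1 mul1r.
Qed.

Lemma fbm_L2 t : 0 <= t <= 1 ->
  L1 (fun w => B t w ^+ 2) /\ \int[P]_w B t w ^+ 2 = t `^ (2 * H).
Proof.
move=> t01; apply: ge0_integral_EFinP.
- by apply: measurable_funX; exact: fbm_measurable.
- by move=> w; exact: sqr_ge0.
have := @fbm_covariance _ _ _ _ _ _ fbm t t t01 t01.
rewrite unlock => cov.
under eq_integral do rewrite expr2.
rewrite cov subrr normr0 powR0 ?mulf_neq0 ?gt_eqF// subr0.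
have /andP[t0 _] := t01.
by rewrite ger0_norm//; congr EFin; field.
Qed.

Lemma fbm_Rexp t : 0 <= t <= 1 -> \int[P]_w B t w = 0.
Proof.
move=> t01; have := @fbm_centered _ _ _ _ _ _ fbm t t01.
by rewrite unlock /Rintegral => ->.
Qed.

Lemma fbm_L1M s t : 0 <= s <= 1 -> 0 <= t <= 1 ->
  L1 (fun w => B s w * B t w).
Proof.
move=> s01 t01; apply: L1M_of_L2; do ?exact: fbm_measurable.
  exact: (fbm_L2 s01).1.
exact: (fbm_L2 t01).1.
Qed.

Lemma fbm_cov s t : 0 <= s <= 1 -> 0 <= t <= 1 ->
  \int[P]_w (B s w * B t w) =
  (s `^ (2 * H) + t `^ (2 * H) - `|s - t| `^ (2 * H)) / 2.
Proof.
move=> s01 t01; have := @fbm_covariance _ _ _ _ _ _ fbm s t s01 t01.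
rewrite unlock /Rintegral => -> /=.
have /andP[t0 _] := t01; have /andP[s0 _] := s01.
by rewrite (ger0_norm s0) (ger0_norm t0) mulrC.
Qed.

(** Only distances survive: the terms that depend on a single time
    cancel between increments. *)
Lemma fbm_cov_incr a b c e : 0 <= a <= 1 -> 0 <= b <= 1 -> 0 <= c <= 1 ->
  0 <= e <= 1 ->
  L1 (fun w => (B a w - B b w) * (B c w - B e w)) /\
  \int[P]_w ((B a w - B b w) * (B c w - B e w)) =
  (`|a - e| `^ (2 * H) + `|b - c| `^ (2 * H)
   - `|a - c| `^ (2 * H) - `|b - e| `^ (2 * H)) / 2.
Proof.
move=> a01 b01 c01 e01.
have -> : (fun w => (B a w - B b w) * (B c w - B e w)) =
    fun w => (B a w * B c w + B b w * B e w)
             + (- 1) * (B a w * B e w + B b w * B c w).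
  by apply/funext => w; ring.
have I1 : L1 (fun w => B a w * B c w + B b w * B e w).
  by apply: L1D; exact: fbm_L1M.
have I2 : L1 (fun w => B a w * B e w + B b w * B c w).
  by apply: L1D; exact: fbm_L1M.
split; first by apply: L1D => //; exact: L1Z.
rewrite RintegralD//; last exact: L1Z.
rewrite RintegralZl// !RintegralD//; try exact: fbm_L1M.
by rewrite !fbm_cov//; lra.
Qed.

(** From $|x| \le \frac12(c + x^2/c)$ with $c = \lambda^H$, since
    $E[B_t^2] = t^{2H} \le c^2$. *)
Lemma fbm_Rexp_norm t lam : 0 <= t <= 1 -> 0 < lam -> t <= lam ->
  L1 (fun w => `|B t w|) /\ \int[P]_w `|B t w| <= lam `^ H.
Proof.
move=> t01 l0 tl; have [I2 E2] := fbm_L2 t01.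
have IB : L1 (B t) by apply: L1_of_L2 => //; exact: fbm_measurable.
have In : L1 (fun w => `|B t w|) by have := integrable_norm IB.
split => //.
set c := lam `^ H; have c0 : 0 < c by rewrite powR_gt0.
have /andP[t0 _] := t01.
have tc : t `^ (2 * H) <= c ^+ 2.
  rewrite /c -powR_mulrn ?powR_ge0// -powRrM [H * _]mulrC.
  by rewrite ge0_ler_powR ?mulr_ge0// ?nnegrE// ltW.
apply: (@le_trans _ _ (\int[P]_w (c / 2 + (2 * c)^-1 * B t w ^+ 2))).
  apply: le_Rintegral => //.
    by apply: L1D; [exact: L1_cst | exact: L1Z].
  move=> w _; set x := B t w.
  have : 0 <= (2 * c)^-1 * (`|x| - c) ^+ 2.
    by rewrite mulr_ge0 ?sqr_ge0// invr_ge0 mulr_ge0// ltW.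
  rewrite (_ : _ * _ = (2 * c)^-1 * `|x| ^+ 2 - `|x| + c / 2); last first.
    by field; exact: lt0r_neq0.
  by rewrite real_normK ?num_real//; lra.
rewrite RintegralD//; [|exact: L1_cst|exact: L1Z].
rewrite Rexp_cst RintegralZl// E2.
have : (2 * c)^-1 * t `^ (2 * H) <= (2 * c)^-1 * c ^+ 2.
  by rewrite ler_pM2l// invr_gt0 mulr_gt0.
rewrite (_ : (2 * c)^-1 * c ^+ 2 = c / 2); last by field; exact: lt0r_neq0.
lra.
Qed.

(** A process measurable at each time and continuous in time is the pointwise
    limit of its step approximations $B_{\lfloor sM\rfloor/M}$, which are
    measurable in both variables because they take countably many times. *)
Lemma fbm_jointly_measurable :
  measurable_fun
    (setT `*` [set` `[0, 1]%R] : set (T * measurableTypeR R)%type)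
    (fun z : T * measurableTypeR R => B z.2 z.1).
Proof.
(* the steps outside [0, 1] are set to 0, as nothing is known of B there *)
pose f w s := if 0 <= s <= 1 then B s w else 0.
have mf s : measurable_fun setT (f^~ s).
  by rewrite /f; have [s01|_] := boolP (0 <= s <= 1); first exact: fbm_measurable.
pose g (m : nat) (s : R) : R := (Num.floor (s * m.+1%:R))%:~R / m.+1%:R.
have M0 m : 0 < m.+1%:R :> R by rewrite ltr0n.
have gle m s : g m s <= s by rewrite ler_pdivrMr// floor_le.
have g01 m s : 0 <= s <= 1 -> 0 <= g m s <= 1.
  move=> /andP[s0 s1]; rewrite (le_trans (gle _ _) s1) andbT.
  by rewrite divr_ge0 ?(ltW (M0 m))// ler0z floor_ge_int mulr_ge0// ltW.
apply: (@measurable_fun_cvg _ _ _ _ (fun m z => f z.1 (g m z.2))) => [m|[w s] [_ /= s01]].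
  apply: measurable_funTS => _ A mA; rewrite setTI.
  rewrite (_ : _ @^-1` A = \bigcup_(j : int)
      ((f^~ (j%:~R / m.+1%:R)) @^-1` A `*`
       [set` `[j%:~R / m.+1%:R, (j + 1)%:~R / m.+1%:R[%R])).
    apply: countable_bigcupT_measurable => [|j]; first exact: countableP.
    apply: measurableX; last exact: measurable_itv.
    by rewrite -[X in measurable X]setTI; exact: mf.
  have inE (s : R) j : (s \in `[j%:~R / m.+1%:R, (j + 1)%:~R / m.+1%:R[%R) =
      (Num.floor (s * m.+1%:R) == j).
    by rewrite in_itv/= ler_pdivrMr// ltr_pdivlMr// floor_eq.
  apply/seteqP; split => [[w s] /= Ah|[w s] [j _ [/= Ah]]].
    by exists (Num.floor (s * m.+1%:R)) => //; split => //=; rewrite inE.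
  by rewrite inE => /eqP sj; rewrite /g sj.
have -> : (fun m => f w (g m s)) = (fun m => B (g m s) w).
  by apply/funext => m; rewrite /f g01//.
have gcvg : g^~ s @ \oo --> s.
  apply/cvgrPdist_le => e e0; near=> m.
  rewrite ger0_norm ?subr_ge0// lerBlDl.
  apply: (@le_trans _ _ (g m s + m.+1%:R^-1)).
    rewrite /g -[X in _ <= _ + X]mul1r -mulrDl -[X in _ + X]/(1%:~R) -intrD ler_pdivlMr//.
    by have /andP[_ /ltW] := floor_itv (s * m.+1%:R).
  rewrite lerD2l; apply: ltW; near: m.
  exact: (near_infty_natSinv_lt (PosNum e0)).
have /subspace_continuousP/(_ s s01) := @fbm_continuous _ _ _ _ _ _ fbm w.
apply: cvg_comp => U /= wU.
have gU : \forall m \near \oo, (g m s \in `[0, 1] -> U (g m s)) := gcvg _ wU.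
suff : \forall m \near \oo, U (g m s) by [].
by apply: filterS gU => m; apply; exact: g01.
Unshelve. all: by end_near.
Qed.
End fbm.

(** * Comparison of a solution with its noise *)

Section path_integral.
Context (R : realType).
Local Notation mu := (@lebesgue_measure R).
Implicit Types f : R -> R.

Lemma within_itv_integrable f (t : R) : t <= 1 ->
  {within `[0, 1], continuous f} ->
  mu.-integrable [set` `[0, t]] (EFin \o f).
Proof.
move=> t1 cf; apply: continuous_compact_integrable.
  exact: segment_compact.
apply: (continuous_subspaceW _ cf) => s /=; rewrite !in_itv/= => /andP[-> st].
exact: le_trans st t1.
Qed.

Lemma within_norm f : {within `[0, 1], continuous f} ->
  {within `[0, 1], continuous (fun s => `|f s|)}.
Proof. by move=> cf s; apply: continuous_comp; [exact: cf|exact: norm_continuous]. Qed.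

(** A Gronwall estimate in which $|\beta|\varepsilon < 1$ replaces the
    exponential: $J = \int_0^\varepsilon|x|$ satisfies
    $J \le |\beta|J + \sigma W$, and $x$ differs from $\sigma b$ by at most
    $|\beta|J$. *)
Lemma sde_path_lower_bound (beta sigma eps : R) (x b : R -> R) :
  `|beta| < 1 -> 0 <= sigma -> 0 < eps -> eps <= 1 ->
  {within `[0, 1], continuous x} -> {within `[0, 1], continuous b} ->
  (forall t, 0 <= t <= 1 ->
     x t = - beta * (\int[mu]_(s in `[0, t]) x s) + sigma * b t) ->
  forall t, 0 <= t <= eps ->
  sigma * (b t - `|beta| / (1 - `|beta|) * \int[mu]_(s in `[0, eps]) `|b s|)
    <= x t.
Proof.
move=> hb s0 e0 e1 cx cb eqx.
have cnx := within_norm cx; have cnb := within_norm cb.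
set W := \int[mu]_(s in _) _.
pose J := \int[mu]_(s in `[0, eps]) `|x s|.
have J0 : 0 <= J by apply: Rintegral_ge0 => s _.
have xJ t : 0 <= t <= eps -> `|\int[mu]_(s in `[0, t]) x s| <= J.
  move=> /andP[t0 te]; have t1 := le_trans te e1.
  apply: (le_trans (le_normr_Rintegral _ (within_itv_integrable t1 cx))) => //.
  apply: fine_le.
  - exact: (integrable_fin_num _ (within_itv_integrable t1 cnx)).
  - exact: (integrable_fin_num _ (within_itv_integrable e1 cnx)).
  apply: ge0_subset_integral => //.
  - by apply: measurable_int; exact: within_itv_integrable e1 cnx.
  by move=> s /=; rewrite !in_itv/= => /andP[-> st]; exact: le_trans st te.
have t01 t : 0 <= t <= eps -> 0 <= t <= 1.
  by move=> /andP[-> te]; exact: le_trans te e1.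
have Ib := within_itv_integrable e1 cnb.
have mE : measurable ([set` `[0, eps]%R] : set (measurableTypeR R)).
  exact: measurable_itv.
have JW : J <= `|beta| * J + sigma * W.
  have -> : sigma * W = \int[mu]_(s in `[0, eps]) (sigma * `|b s|).
    by rewrite RintegralZl.
  have Ic : mu.-integrable [set` `[0, eps]] (EFin \o cst (`|beta| * J)).
    apply: (within_itv_integrable e1); apply: continuous_subspaceT.
    by move=> ?; exact: cvg_cst.
  have Is : mu.-integrable [set` `[0, eps]] (EFin \o (fun s => sigma * `|b s|)).
    by have := integrableZl mE sigma Ib.
  apply: (@le_trans _ _ (\int[mu]_(s in `[0, eps]) (`|beta| * J + sigma * `|b s|))).
    apply: le_Rintegral => //.
    - exact: within_itv_integrable e1 cnx.
    - by have := integrableD mE Ic Is.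
    move=> s; rewrite /= in_itv/= => se; rewrite eqx ?t01//.
    apply: (le_trans (ler_normD _ _)).
    rewrite !normrM normrN [`|sigma|]ger0_norm// lerD2r ler_wpM2l//.
    exact: xJ.
  rewrite RintegralD// Rintegral_cst// lerD2r.
  have muE : mu [set` `[0, eps]] = eps%:E.
    by rewrite lebesgue_measure_itv/= lte_fin e0 sube0.
  rewrite [fine (mu _)](_ : _ = eps); last exact: (congr1 (@fine R) muE).
  by rewrite ler_piMr ?mulr_ge0.
move=> t te; rewrite eqx ?t01//.
have b1 : 0 < 1 - `|beta| by lra.
have J1 : `|beta| * J <= sigma * (`|beta| / (1 - `|beta|) * W).
  have : J <= sigma * W / (1 - `|beta|) by rewrite ler_pdivlMr//; lra.
  move=> /(ler_wpM2l (normr_ge0 beta)); congr (_ <= _).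
  by field; exact: lt0r_neq0.
have := xJ t te; move=> /(ler_wpM2l (normr_ge0 beta)).
rewrite -normrM => h; have := ler_norm (beta * \int[mu]_(s in `[0, t]) x s).
by rewrite mulrBr; lra.
Qed.

End path_integral.

Section fbm_occupation.
Context (d : measure_display) (T : measurableType d) (R : realType).
Variables (P : probability T R) (H : R) (B : R -> T -> R).
Hypothesis fbm : fractional_brownian_motion P H B.
Hypothesis H0 : 0 < H.
Local Notation L1 f := (P.-integrable [set: T] (EFin \o f)).
Local Notation mu := (@lebesgue_measure R).

Lemma fbm_Rexp_path_integral (eps : R) : 0 < eps -> eps <= 1 ->
  let W w := \int[mu]_(s in `[0, eps]) `|B s w| in
  L1 W /\ \int[P]_w W w <= eps * eps `^ H.
Proof.
move=> e0 e1 W.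
pose D : set (T * measurableTypeR R) := setT `*` [set` `[0, eps]%R].
pose F := (EFin \o (fun z : T * measurableTypeR R => `|B z.2 z.1|)) \_ D.
have mD : measurable D by apply: measurableX.
have mF : measurable_fun setT F.
  apply: (measurable_restrictT _ mD).1; apply/measurable_EFinP.
  apply: measurableT_comp => //.
  apply: measurable_funS (fbm_jointly_measurable fbm) => //.
    exact: measurableX.
  move=> [w s] [_ /=]; rewrite !in_itv/= => /andP[-> se]; split => //=.
  exact: le_trans se e1.
have F0 z : (0 <= F z)%E by rewrite /F patchE; case: ifP => // _; rewrite lee_fin.
have FE w : (\int[mu]_s F (w, s) = (W w)%:E)%E.
  rewrite /W /Rintegral fineK; last first.
    apply: integrable_fin_num => //; apply: within_itv_integrable e1 _.
    exact/within_norm/(fbm_continuous fbm).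
  rewrite [RHS]integral_mkcond; apply: eq_integral => s _.
  rewrite /F !patchE /D; congr (if _ then _ else _).
  by apply/idP/idP; rewrite !inE => //= -[].
have mW : measurable_fun setT W.
  apply/measurable_EFinP; rewrite (_ : _ \o _ = fubini_F mu F); last first.
    by apply/funext => w /=; rewrite /fubini_F FE.
  exact: measurable_fun_fubini_tonelli_F.
have W0 w : 0 <= W w by apply: Rintegral_ge0.
have key : (\int[P]_w (W w)%:E <= (eps * eps `^ H)%:E)%E.
  under eq_integral do rewrite -FE.
  rewrite fubini_tonelli//.
  have -> : ((eps * eps `^ H)%:E = \int[mu]_(s in [set` `[0%R, eps]%R]) (eps `^ H)%:E)%E.
    have muE : mu [set` `[0, eps]] = eps%:E.
      by rewrite lebesgue_measure_itv/= lte_fin e0 sube0.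
    rewrite mulrC EFinM integral_cst//.
    by congr (_ * _)%E; rewrite -muE.
  rewrite [leRHS]integral_mkcond; apply: ge0_le_integral => //.
  - by move=> s _; exact: integral_ge0.
  - exact: measurable_fun_fubini_tonelli_G.
  - by apply/(measurable_restrictT _ _).1.
  move=> s _; rewrite patchE; case: ifPn => [|sN].
    rewrite inE/= in_itv/= => /andP[s0 se].
    have s01 : 0 <= s <= 1 by rewrite s0 (le_trans se e1).
    have [I1 I2] := fbm_Rexp_norm fbm H0 s01 e0 se.
    rewrite (eq_integral (fun w => (`|B s w|)%:E)).
      by rewrite -[leLHS]fineK ?lee_fin// integrable_fin_num.
    by move=> w _; rewrite /F patchE ifT// inE; split => //=; rewrite in_itv/= s0.
  rewrite integral0_eq// => w _; rewrite /F patchE ifF//.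
  by apply/negP; rewrite inE => -[_ /= h]; move/negP: sN; apply; rewrite inE.
have IW : L1 W.
  apply/integrableP; split; first exact/measurable_EFinP.
  under eq_integral do rewrite /= ger0_norm//.
  exact: le_lt_trans key (ltry _).
split => //; rewrite -lee_fin /Rintegral fineK//.
exact: integrable_fin_num.
Qed.

End fbm_occupation.

(** * Lower bounds on the expected supremum *)

Section expected_supremum.
Context (d : measure_display) (T : measurableType d) (R : realType).
Variable P : probability T R.
Local Notation L1 f := (P.-integrable [set: T] (EFin \o f)).

(** The integral of a nonnegative function is a supremum over the simple
    functions below it, hence monotone even among nonmeasurable functions:
    the supremum of a process is an arbitrary function of the outcome. *)
Lemma le_ge0_integral (f g : T -> \bar R) :
  (forall w, 0 <= f w)%E -> (forall w, f w <= g w)%E ->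
  (\int[P]_w f w <= \int[P]_w g w)%E.
Proof.
move=> f0 fg.
have g0 w : (0 <= g w)%E by exact: le_trans (f0 w) (fg w).
rewrite !ge0_integralTE//; apply: le_ereal_sup => _ [h hf <-].
by exists h => // w; exact: le_trans (hf w) (fg w).
Qed.

Lemma Rexp_le_expectation (g S : T -> R) : L1 g -> (forall w, 0 <= S w) ->
  (forall w, g w <= S w) -> ((\int[P]_w g w)%:E <= 'E_P[S])%E.
Proof.
move=> Ig S0 gS; rewrite unlock.
have mg := L1_measurable Ig.
have Ip : L1 (fun w => Num.max (g w) 0).
  apply: (@L1_dom _ _ _ _ _ (fun w => `|g w|)).
  - exact: measurable_maxr.
  - by have := integrable_norm Ig.
  - by move=> w; case: (lerP (g w) 0) => h; rewrite ?normr0 ?normr_ge0.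
apply: (@le_trans _ _ (\int[P]_w (Num.max (g w) 0)%:E)%E).
  rewrite /Rintegral fineK; last exact: integrable_fin_num.
  by apply: le_integral => // w _; rewrite lee_fin le_max lexx.
apply: le_ge0_integral => w; first by rewrite lee_fin le_max lexx orbT.
by rewrite lee_fin ge_max gS S0.
Qed.

Variables (H : R) (B X : R -> T -> R) (beta sigma : R).
Hypothesis H0 : 0 < H.
Hypothesis fbm : fractional_brownian_motion P H B.
Hypothesis sde : linear_sde_solution beta sigma B X.
Hypothesis X0 : forall w, X 0 w = 0.
Hypothesis beta1 : `|beta| < 1.
Hypothesis sigma0 : 0 <= sigma.

Let supX w := sup [set X t w | t in `[0%R, 1%R]].

Lemma le_sup_path w t : 0 <= t <= 1 -> X t w <= supX w.
Proof.
move=> t01; have [c _ cmax] := EVT_max ler01 (@sde_continuous _ _ _ _ _ _ sde w).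
apply: ub_le_sup; last by exists t => //=; rewrite in_itv.
by exists (X c w) => _ [s /= s01 <-]; exact: cmax.
Qed.

(** The pathwise bound behind it is
    $\sup X \ge \sigma(u\zeta - A' - \kappa W)$: where $\zeta \le 0$ the right
    side is nonpositive while $\sup X \ge X_0 = 0$, and elsewhere some
    $B_{t_k}$ exceeds $u + A$. *)
Lemma expected_sup_ge (eps u C : R) (n : nat) (t : 'I_n.+1 -> R)
    (A A' zeta : T -> R) :
  0 < eps -> eps <= 1 -> (forall k, 0 <= t k <= eps) -> 0 <= u ->
  (forall w, `|A w| <= A' w) -> L1 A' ->
  L1 zeta -> (4 * C)^-1 <= \int[P]_w zeta w ->
  (forall w, zeta w <= 0 \/
    (zeta w <= 1 /\ exists k, u <= B (t k) w - A w)) ->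
  ((sigma * (u / (4 * C) - \int[P]_w A' w
     - `|beta| / (1 - `|beta|) * (eps * eps `^ H)))%:E <= 'E_P[supX])%E.
Proof.
move=> e0 e1 te u0 AA' IA' Iz Ez hz.
set kappa := `|beta| / (1 - `|beta|).
have k0 : 0 <= kappa by rewrite divr_ge0 ?subr_ge0 ?(ltW beta1).
have [IW EW] := fbm_Rexp_path_integral fbm H0 e0 e1.
set W := fun w => _ in IW EW.
have W0 w : 0 <= W w by apply: Rintegral_ge0.
have S0 w : 0 <= supX w by rewrite -(X0 w) le_sup_path// lexx ler01.
have XB w s : 0 <= s <= eps -> sigma * (B s w - kappa * W w) <= supX w.
  move=> se; have s01 : 0 <= s <= 1.
    by case/andP: se => -> /le_trans; apply.
  apply: le_trans (le_sup_path w s01).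
  apply: (@sde_path_lower_bound _ beta sigma eps (X^~ w) (B^~ w)) => //.
  - exact: @sde_continuous _ _ _ _ _ _ sde w.
  - exact: @fbm_continuous _ _ _ _ _ _ fbm w.
  - by move=> r r01; rewrite (sde_equation sde)// X0 sub0r mulNr.
have IWA : L1 (fun w => (- 1) * A' w + (- kappa) * W w).
  by apply: L1D; exact: L1Z.
have Ig : L1 (fun w => u * zeta w + ((- 1) * A' w + (- kappa) * W w)).
  by apply: L1D => //; exact: L1Z.
apply: le_trans (Rexp_le_expectation (L1Z sigma Ig) S0 _).
  rewrite lee_fin RintegralZl// ler_wpM2l// RintegralD//; last exact: L1Z.
  rewrite RintegralD//; [|exact: L1Z|exact: L1Z]; rewrite !RintegralZl//.
  have := ler_wpM2l u0 Ez; have := ler_wpM2l k0 EW; lra.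
move=> w; have A0 := le_trans (normr_ge0 _) (AA' w).
have := mulr_ge0 k0 (W0 w) => kW.
have [z0|[z1 [k hk]]] := hz w.
  apply: le_trans (S0 w); rewrite mulr_ge0_le0//.
  by have := mulr_ge0_le0 u0 z0; lra.
apply: le_trans (XB w _ (te k)); rewrite ler_wpM2l//.
have := ler_wpM2l u0 z1; have := AA' w; rewrite ler_norml => /andP[]; lra.
Qed.

(** Second moment method for the one variable $B_\varepsilon$, of variance
    $q^2$ with $q = \varepsilon^H$: the choice $b = 2/q$ makes the second
    moment $e^4$ and the threshold $q/2$. *)
Lemma expected_sup_ge_cst (eps : R) : 0 < eps -> eps <= 1 -> H <= 1 ->
  `|beta| / (1 - `|beta|) * eps <= (16 * expR 4)^-1 ->
  ((sigma * (eps / (16 * expR 4)))%:E <= 'E_P[supX])%E.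
Proof.
move=> e0 e1 H1 he.
have e01 : 0 <= eps <= 1 by rewrite ltW.
set q := eps `^ H; have q0 : 0 < q by rewrite powR_gt0.
have q2 : eps `^ (2 * H) = q ^+ 2.
  by rewrite /q -powR_mulrn ?powR_ge0// -powRrM [H * _]mulrC.
have eq : eps <= q.
  by apply: ger1_powR => //; rewrite e0.
pose Y (k : 'I_1) := B eps.
have [I2 E2] := fbm_L2 fbm H0 e01.
have EYY : \int[P]_w (B eps w * B eps w) = q ^+ 2.
  by rewrite -q2 -E2; apply: eq_Rintegral => w _; rewrite expr2.
have gB := fun a => fbm_gaussian fbm a (fun _ : 'I_1 => e01).
have [zeta [Iz Ez hz]] : exists zeta : T -> R,
    [/\ L1 zeta, (4 * expR 4)^-1 <= \int[P]_w zeta w &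
    forall w, zeta w <= 0 \/ (zeta w <= 1 /\ exists k, q / 2 <= Y k w)].
  apply: (@gaussian_max_second_moment _ _ _ _ _ Y (2 / q)) => //.
  - move=> k; have := gB (fun=> 1); congr gaussian_rv.
    by apply/funext => w; rewrite big_ord1 mul1r.
  - move=> k l; have := gB (fun=> 2); congr gaussian_rv.
    by apply/funext => w; rewrite big_ord1 mulr_natl mulr2n.
  - by move=> k; rewrite /Y (fbm_Rexp fbm e01).
  - by rewrite divr_gt0.
  - rewrite !big_ord1 EYY expr1n mul1r ler_expR -exprMn divfK ?gt_eqF//.
    by rewrite -natrX.
  - by move=> k; rewrite EYY le_eqVlt; apply/orP; left; apply/eqP; field; exact: lt0r_neq0.
have hz' w : zeta w <= 0 \/ (zeta w <= 1 /\
    exists k : 'I_1, q / 2 <= B eps w - cst 0 w).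
  by have [|[z1 [k hk]]] := hz w; [left|right; split => //; exists k; rewrite subr0].
have := @expected_sup_ge eps (q / 2) (expR 4) 0 (fun=> eps) (cst 0) (cst 0) zeta
  e0 e1 _ _ _ (L1_cst P 0) Iz Ez hz'.
have E4 := @expR_gt0 R 4.
move=> /(_ _)-/(_ _)-/(_ _)h; apply: le_trans (h _ _ _).
- rewrite lee_fin ler_wpM2l// Rexp_cst -/q {h hz hz'}.
  have /(ler_wpM2r (ltW q0)) h1 := he.
  have : eps / (16 * expR 4) <= q / (16 * expR 4).
    by rewrite ler_pM2r// invr_gt0 mulr_gt0.
  have -> : q / 2 / (4 * expR 4) = 2 * (q / (16 * expR 4)).
    by field; exact: lt0r_neq0.
  move=> h2; lra.
- by move=> _; rewrite lexx ltW.
- by rewrite divr_ge0// ltW.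
- by move=> w /=; rewrite normr0.
Qed.

End expected_supremum.

(** * Sums over a uniform grid *)

Section grid_sums.
Context (R : realType).

(** Telescoping, as $1/\sqrt{j+1} \le 2(\sqrt{j+1}-\sqrt j)$. *)
Lemma sum_inv_sqrt (m : nat) :
  \sum_(0 <= j < m) (Num.sqrt (j.+1%:R : R))^-1 <= 2 * Num.sqrt m%:R.
Proof.
elim: m => [|m IH]; first by rewrite big_geq// mulr_ge0.
rewrite big_nat_recr//=; apply: le_trans (lerD IH (lexx _)) _.
set x := Num.sqrt m%:R; set y := Num.sqrt m.+1%:R.
have x0 : 0 <= x by exact: sqrtr_ge0.
have y0 : 0 < y by rewrite sqrtr_gt0.
have xy : x ^+ 2 + 1 = y ^+ 2 by rewrite !sqr_sqrtr// -natr1.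
rewrite -(@ler_pM2r _ y)// mulrDl mulVf ?gt_eqF//.
nra.
Qed.

Lemma sum_inv_sqrt_dist (n : nat) (k : 'I_n) :
  \sum_(l < n | l != k) (Num.sqrt `|k%:R - l%:R|)^-1
    <= 4 * Num.sqrt n%:R :> R.
Proof.
pose F (l : nat) : R := (Num.sqrt `|k%:R - l%:R|)^-1.
rewrite -(big_mkord (fun l => l != k :> nat) F).
rewrite (@big_cat_nat _ _ _ k)//=; last exact: ltnW.
rewrite [X in _ + X]big_ltn_cond// eqxx/=.
have -> : \sum_(0 <= l < k | l != k :> nat) F l =
    \sum_(0 <= j < k) (Num.sqrt (j.+1%:R : R))^-1.
  transitivity (\sum_(0 <= l < k) F l).
    by rewrite big_nat_cond [RHS]big_nat_cond; apply: eq_bigl => l; lia.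
  rewrite big_nat_rev/= add0n; apply: eq_big_nat => j /andP[_ jk].
  rewrite /F natrB; last by lia.
  by rewrite opprB addrC subrK normr_nat.
have -> : \sum_(k.+1 <= l < n | l != k :> nat) F l =
    \sum_(0 <= j < n - k.+1) (Num.sqrt (j.+1%:R : R))^-1.
  transitivity (\sum_(k.+1 <= l < n) F l).
    by rewrite big_nat_cond [RHS]big_nat_cond; apply: eq_bigl => l; lia.
  rewrite -{1}[k.+1]add0n big_addn; apply: eq_big_nat => j /andP[_ jk].
  rewrite /F distrC -natrB; last by lia.
  by rewrite normr_nat (_ : (j + k.+1 - k)%N = j.+1)//; lia.
have := sum_inv_sqrt k; have := sum_inv_sqrt (n - k.+1).
have : Num.sqrt k%:R <= Num.sqrt n%:R :> R.
  by rewrite ler_wsqrtr// ler_nat ltnW.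
have : Num.sqrt (n - k.+1)%:R <= Num.sqrt n%:R :> R.
  by rewrite ler_wsqrtr// ler_nat leq_subr.
lra.
Qed.

Lemma inv_sqrtE (x : R) : 0 < x -> (Num.sqrt x)^-1 = expR (- (ln x / 2)).
Proof.
move=> x0; rewrite -powR12_sqrt ?ltW// /powR gt_eqF// expRN.
by rewrite mulrC.
Qed.

(** Where the logarithmic correlation comes from: $e^y \ge 1 + y$ at
    $y = 2H\log x$. *)
Lemma one_sub_powR_le (H x : R) : 0 < x -> 1 - x `^ (2 * H) <= 2 * H * - ln x.
Proof.
move=> x0; rewrite /powR gt_eqF//.
by have := expR_ge1Dx (2 * H * ln x); lra.
Qed.

Lemma one_sub_powR_le_inv_sqrt (H x : R) : 0 < H -> 0 < x ->
  1 - x `^ (2 * H) <= 4 * H * (Num.sqrt x)^-1.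
Proof.
move=> H0 x0; apply: le_trans (one_sub_powR_le H x0) _.
rewrite inv_sqrtE//; have := expR_ge1Dx (- (ln x / 2)) => h.
have : H * - ln x <= H * (2 * expR (- (ln x / 2))) by rewrite ler_pM2l//; lra.
lra.
Qed.

Lemma expR_one_sub_powR_le (H x : R) : 0 < H -> 0 < x ->
  expR ((1 - x `^ (2 * H)) / (4 * H)) <= (Num.sqrt x)^-1.
Proof.
move=> H0 x0; rewrite inv_sqrtE// ler_expR ler_pdivrMr ?mulr_gt0//.
by have := one_sub_powR_le H x0; lra.
Qed.

End grid_sums.

(** * The covariance of the noise recentered on a grid *)

Section grid_distances.
Context (R : realType) (H : R) (n : nat).
Hypothesis H0 : 0 < H.
Local Notation N := (n.+1%:R : R).

(** $N = n+1$ points; the last one is $1 - 1/N$, which keeps the indices in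
    'I_n.+1 without affecting the estimates. *)
Definition grid (k : 'I_n.+1) : R := k%:R / N.
Definition grid_incr (k l : 'I_n.+1) : R := `|grid k - grid l| `^ (2 * H).
Definition grid_row (k : 'I_n.+1) : R := N^-1 * \sum_j grid_incr k j.
Definition grid_mean : R := N^-1 * \sum_k grid_row k.

Lemma grid01 k : 0 <= grid k <= 1.
Proof.
rewrite divr_ge0//= ler_pdivrMr ?ltr0n// mul1r ler_nat.
by rewrite ltnW// ltn_ord.
Qed.

Lemma grid_incrC k l : grid_incr k l = grid_incr l k.
Proof. by rewrite /grid_incr distrC. Qed.

Lemma grid_incr_diag k : grid_incr k k = 0.
Proof. by rewrite /grid_incr subrr normr0 powR0// mulf_neq0 ?gt_eqF. Qed.

Lemma grid_dist k l : `|grid k - grid l| = `|k%:R - l%:R| / N.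
Proof. by rewrite /grid -mulrBl normrM [`|N^-1|]ger0_norm ?invr_ge0. Qed.

Lemma grid_dist_gt0 k l : l != k -> 0 < `|grid k - grid l|.
Proof.
move=> lk; rewrite grid_dist divr_gt0 ?ltr0n// normr_gt0 subr_eq0 eqr_nat.
by apply: contraNneq lk => /val_inj ->.
Qed.

Lemma grid_incr_le1 k l : grid_incr k l <= 1.
Proof.
rewrite /grid_incr; have /andP[k0 k1] := grid01 k; have /andP[l0 l1] := grid01 l.
apply: (@le_trans _ _ (1 `^ (2 * H))); last by rewrite powR1.
rewrite ge0_ler_powR ?nnegrE// ?mulr_ge0 ?(ltW H0)//.
by rewrite ler_norml; lra.
Qed.

Lemma sum_grid_inv_sqrt k :
  \sum_(l | l != k) (Num.sqrt `|grid k - grid l|)^-1 <= 4 * N.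
Proof.
have N0 : 0 < N by rewrite ltr0n.
rewrite (eq_bigr (fun l : 'I_n.+1 =>
  Num.sqrt N * (Num.sqrt `|k%:R - l%:R|)^-1)); last first.
  move=> l _; rewrite grid_dist sqrtrM// sqrtrV ?(ltW N0)//.
  by rewrite invfM invrK mulrC.
rewrite -mulr_sumr.
have := @sum_inv_sqrt_dist R n.+1 k.
move=> /(ler_wpM2l (sqrtr_ge0 N)); congr (_ <= _).
by rewrite mulrCA -expr2 sqr_sqrtr// ltW.
Qed.

Lemma sum_one_sub_grid_incr k : \sum_l (1 - grid_incr k l) <= 1 + 16 * H * N.
Proof.
rewrite (bigD1 k)//= grid_incr_diag subr0 lerD2l.
apply: (@le_trans _ _ (\sum_(l | l != k)
    4 * H * (Num.sqrt `|grid k - grid l|)^-1)).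
  apply: ler_sum => l lk.
  exact: one_sub_powR_le_inv_sqrt (grid_dist_gt0 lk).
rewrite -mulr_sumr.
have H4 : 0 <= 4 * H by rewrite mulr_ge0// ltW.
have := ler_wpM2l H4 (sum_grid_inv_sqrt k); lra.
Qed.

Lemma grid_row_ge k : 1 - (N^-1 + 16 * H) <= grid_row k.
Proof.
have N0 : 0 < N by rewrite ltr0n.
have := sum_one_sub_grid_incr k.
rewrite big_split/= sumr_const card_ord sumrN => h.
rewrite /grid_row [leRHS]mulrC ler_pdivlMr// mulrBl mulrDl mulVf ?gt_eqF//; lra.
Qed.

Lemma grid_row_le1 k : grid_row k <= 1.
Proof.
have N0 : 0 < N by rewrite ltr0n.
rewrite /grid_row [leLHS]mulrC ler_pdivrMr// mul1r.
apply: (@le_trans _ _ (\sum_(l < n.+1) 1)); last by rewrite sumr_const card_ord.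
by apply: ler_sum => l _; exact: grid_incr_le1.
Qed.

Lemma grid_mean_ge : 1 - (N^-1 + 16 * H) <= grid_mean.
Proof.
have N0 : 0 < N by rewrite ltr0n.
rewrite /grid_mean [leRHS]mulrC ler_pdivlMr//.
apply: (@le_trans _ _ (\sum_(k < n.+1) (1 - (N^-1 + 16 * H)))).
  by rewrite sumr_const card_ord mulr_natr.
by apply: ler_sum => k _; exact: grid_row_ge.
Qed.

Lemma grid_mean_le1 : grid_mean <= 1.
Proof.
have N0 : 0 < N by rewrite ltr0n.
rewrite /grid_mean [leLHS]mulrC ler_pdivrMr// mul1r.
apply: (@le_trans _ _ (\sum_(l < n.+1) 1)); last by rewrite sumr_const card_ord.
by apply: ler_sum => l _; exact: grid_row_le1.
Qed.

(** The covariance of $B_{t_k} - A$ and $B_{t_l} - A$; see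
    fbm_grid_centeredM. *)
Definition grid_cov k l :=
  (grid_row k + grid_row l - grid_incr k l - grid_mean) / 2.

(** With $b^2 = 1/(2H)$ each off-diagonal term is at most
    $e^5|t_k-t_l|^{-1/2}$, the factor $e^5$ absorbing the defect of the mean
    squared distance from 1.  A diagonal term can be as large as
    $e^5e^{1/(4H)}$, which the number of points compensates. *)
Lemma sum_expR_grid_cov (b : R) : b ^+ 2 = (2 * H)^-1 ->
  expR (4 * H)^-1 <= N ->
  \sum_k \sum_l expR (b ^+ 2 * grid_cov k l) <= N ^+ 2 * (5 * expR 5).
Proof.
move=> b2 HN.
have N0 : 0 < N by rewrite ltr0n.
have H4 : 0 < 4 * H by rewrite mulr_gt0.
have NH : (4 * H)^-1 <= N by have := expR_ge1Dx (4 * H)^-1; lra.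
have mean5 : (1 - grid_mean) / (4 * H) <= 5.
  rewrite ler_pdivrMr//.
  have : N^-1 <= 4 * H by rewrite -[4 * H]invrK lef_pV2// posrE invr_gt0.
  by have := grid_mean_ge; set v := N^-1 => h1 h2; lra.
have cov_le k l : expR (b ^+ 2 * grid_cov k l) <=
    expR 5 * expR ((1 - grid_incr k l) / (4 * H)).
  rewrite -expRD ler_expR.
  apply: (@le_trans _ _ ((1 - grid_mean) / (4 * H) +
      (1 - grid_incr k l) / (4 * H))); last by rewrite lerD2r.
  rewrite b2 /grid_cov.
  rewrite (_ : (2 * H)^-1 * _ = (grid_row k + grid_row l - grid_incr k l
     - grid_mean) / (4 * H)); last by field; exact: lt0r_neq0.
  rewrite -mulrDl ler_pM2r ?invr_gt0//.
  by have := grid_row_le1 k; have := grid_row_le1 l; lra.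
have row_le k : \sum_l expR ((1 - grid_incr k l) / (4 * H)) <= 5 * N.
  rewrite (bigD1 k)//= grid_incr_diag subr0 mul1r.
  have : \sum_(l | l != k) expR ((1 - grid_incr k l) / (4 * H)) <= 4 * N.
    apply: le_trans (sum_grid_inv_sqrt k); apply: ler_sum => l lk.
    exact: expR_one_sub_powR_le (grid_dist_gt0 lk).
  lra.
apply: (@le_trans _ _ (\sum_(k < n.+1) expR 5 * (5 * N))).
  apply: ler_sum => k _.
  apply: le_trans (ler_sum _ (fun l _ => cov_le k l)) _.
  by rewrite -mulr_sumr ler_pM2l ?expR_gt0.
rewrite sumr_const card_ord -[leLHS]mulr_natr.
by rewrite le_eqVlt; apply/orP; left; apply/eqP; ring.
Qed.

End grid_distances.

Section fbm_grid.
Context (d : measure_display) (T : measurableType d) (R : realType).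
Variables (P : probability T R) (H : R) (B : R -> T -> R).
Hypothesis fbm : fractional_brownian_motion P H B.
Hypothesis H0 : 0 < H.
Local Notation L1 f := (P.-integrable [set: T] (EFin \o f)).
Variable n : nat.
Local Notation N := (n.+1%:R : R).
Local Notation t := (@grid R n).

Definition fbm_average w : R := N^-1 * \sum_(i < n.+1) B (t i) w.

Let Y (k : 'I_n.+1) w : R := B (t k) w - fbm_average w.

(** $B_{t_k} - A$ is the average of the increments $B_{t_k} - B_{t_j}$. *)
Lemma fbm_grid_centeredM k l : L1 (fun w => Y k w * Y l w) /\
  \int[P]_w (Y k w * Y l w) = grid_cov H k l.
Proof.
have N0 : N != 0 by rewrite pnatr_eq0.
have YE i w : Y i w = N^-1 * \sum_(j < n.+1) (B (t i) w - B (t j) w).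
  rewrite sumrB sumr_const card_ord mulrBr; congr (_ - _).
  by rewrite -[B _ _ *+ _]mulr_natl mulKf.
have YYE : (fun w => Y k w * Y l w) = fun w => (N^-1 * N^-1) *
    \sum_(i < n.+1) \sum_(j < n.+1)
      (B (t k) w - B (t i) w) * (B (t l) w - B (t j) w).
  apply/funext => w; rewrite !YE mulrACA; congr (_ * _).
  by rewrite mulr_suml; apply: eq_bigr => i _; rewrite mulr_sumr.
have I2 i j : L1 (fun w => (B (t k) w - B (t i) w) * (B (t l) w - B (t j) w)).
  by apply: (fbm_cov_incr fbm H0 _ _ _ _).1; exact: grid01.
rewrite YYE; split; first by apply: L1Z; do 2 apply: L1_sum => ?.
rewrite RintegralZl//; last by do 2 apply: L1_sum => ?.
rewrite Rexp_sum; last by move=> i; apply: L1_sum.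
under eq_bigr => i _.
  rewrite Rexp_sum//.
  under eq_bigr => j _.
    rewrite (fbm_cov_incr fbm H0 _ _ _ _).2 ?grid01// -!/(grid_incr H _ _).
    over.
  rewrite -mulr_suml !sumrB big_split/= !sumr_const !card_ord.
  over.
rewrite -mulr_suml !sumrB big_split/= !sumr_const !card_ord.
have rowE (i : 'I_n.+1) : \sum_j grid_incr H i j = N * grid_row H i.
  by rewrite /grid_row mulVKf.
have -> : \sum_(i < n.+1) (\sum_(j < n.+1) grid_incr H i j) =
    N * N * grid_mean H n.
  by under eq_bigr do rewrite rowE; rewrite -mulr_sumr /grid_mean -mulrA mulVKf.
under [X in _ * ((_ + X - _ - _) / _)]eq_bigr do rewrite grid_incrC.
rewrite sumrMnl !rowE.
have mulN (x : R) : x *+ n.+1 = N * x by rewrite mulr_natl.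
move: N0 mulN; set M : R := n.+1%:R => M0 mulN.
by rewrite !mulN /grid_cov; field.
Qed.

Lemma fbm_grid_gaussian (b : 'I_n.+1 -> R) :
  gaussian_rv P (fun w => \sum_(i < n.+1) b i * B (t i) w).
Proof. by apply: (fbm_gaussian fbm) => i; exact: grid01. Qed.

End fbm_grid.

(** * The bound of order $H^{-1/2}$, and the theorem *)

Section expected_supremum_grid.
Context (d : measure_display) (T : measurableType d) (R : realType).
Variable P : probability T R.
Local Notation L1 f := (P.-integrable [set: T] (EFin \o f)).
Variables (H : R) (B X : R -> T -> R) (beta sigma : R).
Hypothesis H0 : 0 < H.
Hypothesis fbm : fractional_brownian_motion P H B.
Hypothesis sde : linear_sde_solution beta sigma B X.
Hypothesis X0 : forall w, X 0 w = 0.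
Hypothesis beta1 : `|beta| < 1.
Hypothesis sigma0 : 0 <= sigma.

(** The constant 320 is $16 \cdot 4 \cdot 5$: the threshold $b/16$ over four
    times the second moment bound $5e^5$. *)
Lemma expected_sup_ge_sqrt : H <= 80^-1 ->
  ((sigma * ((Num.sqrt (2 * H))^-1 / (320 * expR 5) - 1
     - `|beta| / (1 - `|beta|)))%:E
   <= 'E_P[fun w => sup [set X t w | t in `[0%R, 1%R]]])%E.
Proof.
move=> H80.
have H2 : 0 < 2 * H by rewrite mulr_gt0.
set b := (Num.sqrt (2 * H))^-1.
have b0 : 0 < b by rewrite invr_gt0 sqrtr_gt0.
have b2 : b ^+ 2 = (2 * H)^-1 by rewrite exprVn sqr_sqrtr// ltW.
have [n HN] : exists n : nat, expR (4 * H)^-1 <= n.+1%:R.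
  exists (Num.bound (expR (4 * H)^-1)); apply: ltW.
  apply: (@lt_le_trans _ _ (Num.bound (expR (4 * H)^-1))%:R).
    exact: archi_boundP (expR_ge0 _).
  by rewrite ler_nat.
set N : R := n.+1%:R in HN *.
have N0 : 0 < N by rewrite ltr0n.
pose t := @grid R n.
have t01 k : 0 <= t k <= 1 by exact: grid01.
pose A := fbm_average B n.
pose Y (k : 'I_n.+1) w := B (t k) w - A w.
have mB k : measurable_fun setT (B (t k)) by exact: fbm_measurable fbm _ (t01 k).
have IB k : L1 (B (t k)).
  by apply: L1_of_L2 => //; exact: (fbm_L2 fbm H0 (t01 k)).1.
have IA : L1 A by apply: L1Z; exact: L1_sum.
have YE k w : Y k w = \sum_(i < n.+1) ((i == k)%:R - N^-1) * B (t i) w.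
  under eq_bigr do rewrite mulrBl.
  rewrite sumrB (bigD1 k)//= eqxx mul1r big1 ?addr0; last first.
    by move=> i /negPf ->; rewrite mul0r.
  by rewrite -mulr_sumr.
have [zeta [Iz Ez hz]] : exists zeta : T -> R,
    [/\ L1 zeta, (4 * (5 * expR 5))^-1 <= \int[P]_w zeta w &
    forall w, zeta w <= 0 \/ (zeta w <= 1 /\ exists k, b / 16 <= Y k w)].
  apply: (@gaussian_max_second_moment _ _ _ _ _ Y b) => //.
  - move=> k; have := fbm_grid_gaussian fbm (fun i : 'I_n.+1 => (i == k)%:R - N^-1).
    by congr gaussian_rv; apply/funext => w; rewrite YE.
  - move=> k l; have := fbm_grid_gaussian fbm
      (fun i : 'I_n.+1 => ((i == k)%:R - N^-1) + ((i == l)%:R - N^-1)).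
    congr gaussian_rv; apply/funext => w; rewrite !YE -big_split/=.
    by apply: eq_bigr => i _; rewrite mulrDl.
  - move=> k; have := (fbm_grid_centeredM fbm H0 k k).1.
    by congr (_.-integrable _ _); apply/funext => w /=; rewrite expr2.
  - move=> k; under eq_Rintegral do rewrite YE.
    rewrite Rexp_sum => [|i]; last exact: L1Z.
    by rewrite big1// => i _; rewrite RintegralZl// (fbm_Rexp fbm)// mulr0.
  - under eq_bigr do under eq_bigr do rewrite (fbm_grid_centeredM fbm H0 _ _).2.
    exact: sum_expR_grid_cov.
  move=> k; rewrite (fbm_grid_centeredM fbm H0 k k).2.
  have NH : N^-1 <= 4 * H.
    rewrite -[4 * H]invrK lef_pV2 ?posrE// ?invr_gt0 ?mulr_gt0//.
    by have := expR_ge1Dx (4 * H)^-1; lra.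
  have c4 : 4^-1 <= grid_cov H k k.
    rewrite /grid_cov grid_incr_diag// ler_pdivlMr//.
    have := grid_row_ge H0 k; have := @grid_mean_le1 R H n H0.
    set v := N^-1 in NH *; lra.
  have b16 : 16 <= b ^+ 2.
    rewrite b2 -[16]invrK lef_pV2 ?posrE ?invr_gt0//.
    lra.
  have bi : b^-1 <= b / 16.
    rewrite -(@ler_pM2l _ b)// mulfV ?gt_eqF// mulrA -expr2; lra.
  have := ler_wpM2l (ltW b0) c4; lra.
pose A' w : R := N^-1 * \sum_(i < n.+1) `|B (t i) w|.
have In i : L1 (fun w => `|B (t i) w|).
  exact: (fbm_Rexp_norm fbm H0 (t01 i) ltr01 (proj2 (andP (t01 i)))).1.
have IA' : L1 A' by apply: L1Z; exact: L1_sum.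
have EA' : \int[P]_w A' w <= 1.
  rewrite RintegralZl//; last exact: L1_sum.
  rewrite Rexp_sum// mulrC ler_pdivrMr// mul1r.
  apply: (@le_trans _ _ (\sum_(i < n.+1) 1)); last by rewrite sumr_const card_ord.
  apply: ler_sum => i _.
  have := (fbm_Rexp_norm fbm H0 (t01 i) ltr01 (proj2 (andP (t01 i)))).2.
  by rewrite powR1.
have AA' w : `|A w| <= A' w.
  rewrite /A /fbm_average normrM gtr0_norm ?invr_gt0// ler_pM2l ?invr_gt0//.
  exact: ler_norm_sum.
have b16 : 0 <= b / 16 by rewrite divr_ge0// ltW.
have h := @expected_sup_ge _ _ _ P H B X beta sigma H0 fbm sde X0 beta1 sigma0
  1 (b / 16) (5 * expR 5) n t A A' zeta ltr01 (lexx _) t01 b16 AA' IA' Iz Ez hz.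
apply: le_trans h; rewrite lee_fin ler_wpM2l// powR1 !mulr1 lerD2r.
have -> : b / 16 / (4 * (5 * expR 5)) = b / (320 * expR 5).
  by field; rewrite gt_eqF// expR_gt0.
lra.
Qed.

End expected_supremum_grid.

Theorem theorem2 (R : realType) (beta sigma : R)
    (hbeta : `|beta| < 1)
    (hsigma : expR (2 * `|beta| - 2^-1) < sigma) :
  let C_beta := expR (- (2 * `|beta|)) in
  exists c : R, 0 < c /\
    forall H : R, 0 < H -> H < 1 ->
    forall (d : measure_display) (T : measurableType d)
      (P : probability T R) (B X : R -> T -> R),
      fractional_brownian_motion P H B ->
      linear_sde_solution beta sigma B X ->
      (forall w : T, X 0 w = 0) ->
      ((c * (expR (- 2^-1) *
             Num.sqrt (H^-1 * ln (sigma * C_beta / expR (- 2^-1)))))%:E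
       <= 'E_P[fun w => sup [set X t w | t in `[0%R, 1%R]]])%E.
Proof.
move=> C_beta.
have sigma0 : 0 < sigma := lt_trans (expR_gt0 _) hsigma.
set L := ln _.
set kappa := `|beta| / (1 - `|beta|).
have kappa0 : 0 <= kappa by rewrite divr_ge0 ?subr_ge0 ?(ltW hbeta).
set E4 : R := 16 * expR 4.
have E40 : 0 < E4 by rewrite mulr_gt0// expR_gt0.
have E41 : 1 <= E4 by have := expR_ge1Dx (4 : R); rewrite /E4; lra.
pose eps := (E4 * (1 + kappa))^-1.
have eps0 : 0 < eps by rewrite invr_gt0 mulr_gt0//; lra.
have eps1 : eps <= 1.
  rewrite invf_le1 ?mulr_gt0//; last lra.
  by rewrite -[leLHS]mulr1 ler_pM//; lra.
have keps : kappa * eps <= E4^-1.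
  rewrite /eps invfM mulrCA ler_piMr ?invr_ge0 ?(ltW E40)//.
  rewrite ler_pdivrMr; lra.
pose c1 := eps / E4.
have c10 : 0 < c1 by rewrite divr_gt0.
pose c2 := (Num.sqrt 2)^-1 / (320 * expR 5) : R.
have c20 : 0 < c2.
  by rewrite divr_gt0 ?invr_gt0 ?sqrtr_gt0 ?mulr_gt0 ?expR_gt0.
pose c3 := 1 + kappa + 9 * c2.
have c30 : 0 < c3 by rewrite /c3; lra.
pose e : R := expR (- 2^-1).
have e0 : 0 < e by exact: expR_gt0.
have sL0 := sqrtr_ge0 L.
pose D := (1 + c3 / c1) * (e * (Num.sqrt L + 1)).
have D0 : 0 < D.
  rewrite mulr_gt0//; first by have := divr_gt0 c30 c10; lra.
  by rewrite mulr_gt0//; lra.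
exists (sigma * c2 / D); split; first by rewrite divr_gt0// mulr_gt0.
move=> H H0 H1 d T P B X fbm sde X0.
set g := (Num.sqrt H)^-1.
have g0 : 0 < g by rewrite invr_gt0 sqrtr_gt0.
have low1 := expected_sup_ge_cst H0 fbm sde X0 hbeta (ltW sigma0) eps0 eps1
  (ltW H1) keps.
(* for H > 1/80 the left side is negative, since then 1/sqrt H < 9 *)
have low2 : ((sigma * (c2 * g - c3))%:E <=
    'E_P[fun w => sup [set X t w | t in `[0%R, 1%R]]])%E.
  have [H80|H80] := leP H 80^-1.
    apply: le_trans (expected_sup_ge_sqrt H0 fbm sde X0 hbeta (ltW sigma0) H80).
    rewrite lee_fin ler_wpM2l ?(ltW sigma0)// -/kappa.
    rewrite sqrtrM// invfM -/g /c2 /c3.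
    by have := c20; rewrite /c2; lra.
  apply: le_trans low1; rewrite lee_fin ler_wpM2l ?(ltW sigma0)//.
  have g9 : g <= 9.
    rewrite /g -[9]invrK lef_pV2 ?posrE ?invr_gt0 ?sqrtr_gt0//.
    rewrite -[leLHS]ger0_norm ?invr_ge0// -sqrtr_sqr ler_wsqrtr//.
    apply: le_trans (ltW H80); rewrite exprVn lef_pV2 ?posrE ?exprn_gt0//.
    by rewrite expr2; lra.
  have := ler_wpM2l (ltW c20) g9; rewrite /c3; rewrite -/E4 -/c1; lra.
move: low1 low2; set S := ('E_P[_])%E; case: S => [r|_ _|]; [|by rewrite leey|by rewrite leeNy_eq].
rewrite !lee_fin -/E4 -/c1 => low1 low2.
rewrite sqrtrM ?invr_ge0 ?(ltW H0)// sqrtrV ?(ltW H0)// -/g -/e.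
have r0 : 0 < r by apply: lt_le_trans low1; rewrite mulr_gt0.
(* low2 plus c3 / c1 times low1 *)
have key : sigma * c2 * g <= r * (1 + c3 / c1).
  have : sigma * c3 <= r * (c3 / c1).
    have := ler_wpM2r (ltW (divr_gt0 c30 c10)) low1.
    by rewrite (_ : _ * c1 * _ = sigma * c3)//; field; exact: lt0r_neq0.
  by lra.
apply: (@le_trans _ _ (sigma * c2 / D * (e * (g * (Num.sqrt L + 1))))).
  have cD0 : 0 <= sigma * c2 / D by rewrite ltW// divr_gt0// mulr_gt0.
  apply: ler_wpM2l => //; apply: ler_wpM2l; first exact: ltW.
  by apply: ler_wpM2l; [exact: ltW | rewrite lerDl].
rewrite mulrAC ler_pdivrMr//.
have -> : sigma * c2 * (e * (g * (Num.sqrt L + 1))) =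
    sigma * c2 * g * (e * (Num.sqrt L + 1)) by ring.
by rewrite /D [leRHS]mulrA ler_pM2r// mulr_gt0//; lra.
Qed.
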